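(* Let $D$ be a finite directed graph and let $F \subseteq E(D)$ be a set of edges. Then \[ \max \{|F \cap E(\mathcal{C})| \colon \mathcal{C} \text{ is a collection of edge-disjoint (directed) cycles of } D \} \;\ge\;\min \{|Y| \colon Y \subseteq E(D) \text{ hits all $F$-cycles in } D\}. \]
   Context: Cycles in $D$ are directed cycles. An $F$-cycle is a directed cycle of $D$ containing at least one edge of $F$. For a collection $\mathcal{C}$ of cycles, $E(\mathcal{C})$ denotes the set of all edges contained in some cycle of $\mathcal{C}$. A set $Y$ of edges hits a cycle if the cycle contains an edge of $Y$. *)

(* Defs.v *)
From mathcomp Require Import all_boot.

Set Implicit Arguments.
Unset Strict Implicit.
Unset Printing Implicit Defensive.

(* Edges form a type of their own: loops and parallel edges are allowed, and
   simple digraphs are the case where e |-> (src e, tgt e) is injective. *)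
Record digraph := Digraph {
  vertex : finType;
  edge : finType;
  src : edge -> vertex;
  tgt : edge -> vertex
}.

Section Cycles.

Variable D : digraph.
Implicit Types (c : seq (edge D)) (C Y F : {set edge D}).
Implicit Type CC : {set {set edge D}}.

(* The successive edges of a cycle. A loop is a cycle of length 1, two
   antiparallel edges form one of length 2. *)
Definition dicycle_seq c : bool :=
  [&& c != [::], cycle [rel e f | tgt e == src f] c & uniq (map (@src D) c)].

(* A cycle is identified with its edge set, which determines it as a subgraph.
   By [dicycle_seqP] below, the length #|C| loses no cycle. *)
Definition dicycle C : bool :=
  [exists c : #|C|.-tuple (edge D), dicycle_seq c && (C == [set e in c])].

Lemma dicycle_seqP C :
  reflect (exists2 c, dicycle_seq c & C = [set e in c]) (dicycle C).
Proof.
apply: (iffP existsP) => [[c /andP[cc /eqP CE]]|[c cc CE]].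
  by exists (val c) => //; rewrite {1}CE; apply/setP => e; rewrite !inE.
have uc : uniq c by case/and3P: cc => _ _; apply: map_uniq.
have sc : size c == #|C| by rewrite CE cardsE (card_uniqP uc).
exists (Tuple sc); rewrite cc /=; apply/eqP/setP => e.
by rewrite {1}CE !inE.
Qed.

Definition edge_disjoint_dicycles CC : bool :=
  [forall C in CC, dicycle C] && trivIset CC.

Definition F_dicycle F C : bool := dicycle C && (F :&: C != set0).

Definition hits Y C : bool := Y :&: C != set0.

Definition hits_F_dicycles F Y : bool := [forall C, F_dicycle F C ==> hits Y C].

Lemma hits_F_dicycles_setT F : hits_F_dicycles F [set: edge D].
Proof.
apply/forallP => C; apply/implyP => /andP[_ /set0Pn[e]].
by rewrite inE => /andP[_ eC]; apply/set0Pn; exists e; rewrite !inE.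
Qed.

(* [cover CC] is E(CC). The maximum ranges over a nonempty family, since
   [set0] is a collection of edge-disjoint cycles. *)
Definition max_F_covered F : nat :=
  \max_(CC : {set {set edge D}} | edge_disjoint_dicycles CC) #|F :&: cover CC|.

(* The starting point [setT] of [arg min] is a legitimate one by
   [hits_F_dicycles_setT]. *)
Definition min_F_hitting F : nat :=
  #|[arg min_(Y < [set: edge D] | hits_F_dicycles F Y) #|Y|]|.

End Cycles.

(* Main.v *)
Require Import Defs.
From mathcomp Require Import all_boot.
From mathcomp Require Import order ssralg ssrnum ssrint zify lra.

(**
  This is integral duality for maximum-weight circulations of unit capacity.
  Edge-disjoint unions of cycles are exactly the balanced edge sets, so choose a
  balanced [S] maximising [|F :&: S|]. Reversing the edges of [S] gives the
  residual digraph; swapping a residual cycle in or out of [S] keeps [S]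
  balanced, so by maximality no residual cycle gains [F]-edges, and there is an
  integral potential [pi] for the gains. The edges [e] of [S] with positive
  slack [[e \in F] + pi (tgt e) - pi (src e)] then hit every [F]-cycle, and
  since potential differences cancel over [S] the slacks on [S] add up to
  [|F :&: S|].
*)

Set Implicit Arguments.
Unset Strict Implicit.
Unset Printing Implicit Defensive.

Import Order.TTheory GRing.Theory Num.Theory.
Local Open Scope ring_scope.

Section Balanced.

Variable D : digraph.
Implicit Types (e : edge D) (c p : seq (edge D)) (C F S : {set edge D}).

(** Taking [phi] to be the indicator of a vertex gives in-degree equal to out-degree there; this
    form lets potentials cancel directly. *)
Definition balanced S : Prop :=
  forall phi : vertex D -> int,
    \sum_(e in S) (phi (tgt e) - phi (src e)) = 0.

Lemma map_tgt_belast e p :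
  path [rel e f | tgt e == src f] e p ->
  map (@tgt D) (belast e p) = map (@src D) p.
Proof. by elim: p e => //= f p IHp e /andP[/eqP-> /IHp->]. Qed.

Lemma sum_set_seq c (g : edge D -> int) :
  uniq c -> \sum_(e in [set e in c]) g e = \sum_(e <- c) g e.
Proof.
by move=> uc; rewrite [RHS]big_uniq //=; apply: eq_bigl => e; rewrite inE.
Qed.

Lemma dicycle_balanced C : dicycle C -> balanced C.
Proof.
case/dicycle_seqP => c /and3P[_ cyc /map_uniq uc] -> phi.
rewrite sum_set_seq // sumrB -(big_map (@tgt D) predT phi).
rewrite -(big_map (@src D) predT phi).
case: c cyc {uc} => [|e p] cyc; first by rewrite !big_nil subrr.
have := map_tgt_belast cyc; rewrite belast_rcons => ->.
apply/eqP; rewrite subr_eq0; apply/eqP/perm_big.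
by rewrite map_rcons perm_rcons.
Qed.

(** * Potentials from heaviest walks *)

(* A walk listed backwards from its end [v]. *)
Fixpoint walk_to (v : vertex D) p : bool :=
  if p is e :: p' then (tgt e == v) && walk_to (src e) p' else true.

Lemma walk_to_cat v p q :
  walk_to v (p ++ q) = walk_to v p && walk_to (last v (map (@src D) p)) q.
Proof. by elim: p v => //= e p IHp v; rewrite IHp andbA. Qed.

Lemma closed_walk_cycle e p :
  walk_to (tgt e) (e :: p) -> last (src e) (map (@src D) p) = tgt e ->
  cycle [rel e f | tgt e == src f] (rev (e :: p)).
Proof.
rewrite rev_cycle /= rcons_path eqxx /= => wp lp.
suff: path (fun f g => tgt g == src f) e p.
  by move=> ->; rewrite -lp last_map eqxx.
by elim: p e wp {lp} => //= f p IHp e /andP[-> /IHp].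
Qed.

Definition simple_walk_to v p := walk_to v p && uniq (v :: map (@src D) p).

Lemma potential_exists (w : edge D -> int) :
  (forall C, dicycle C -> \sum_(e in C) w e <= 0) ->
  exists pi : vertex D -> int, forall e, w e <= pi (tgt e) - pi (src e).
Proof.
move=> wC.
have size_simple v p : simple_walk_to v p -> (size p <= #|vertex D|)%N.
  case/andP => _ up; have := uniq_leq_size up (fun x _ => mem_enum predT x).
  by rewrite /= size_map -cardE => /ltnW.
pose best v : #|vertex D|.-bseq (edge D) :=
  [arg max_(p > [bseq] | simple_walk_to v (val p)) \sum_(e <- val p) w e]%O.
have bestP v : simple_walk_to v (best v) /\
    forall p, simple_walk_to v p -> \sum_(e <- p) w e <= \sum_(e <- best v) w e.
  rewrite /best; case: arg_maxP => //= b sb max_b; split=> // p sp.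
  exact: (max_b (Bseq (size_simple v p sp))).
exists (fun v => \sum_(e <- best v) w e) => e.
have [/andP[]] := bestP (src e); set p : seq _ := best (src e) => wp up _.
have [_ maxt] := bestP (tgt e).
rewrite lerBrDr.
have [te|te] := boolP (tgt e \in src e :: map (@src D) p); last first.
  rewrite -[leLHS](big_cons 0 +%R e p predT w).
  by apply: maxt; rewrite /simple_walk_to /= eqxx wp te.
(* The best walk to [src e] already visits [tgt e]: it is [q2] followed by
   [q1], and [q1] together with [e] closes up to a cycle. *)
have [q1 [q2 [Dp lq]]] : exists q1 q2,
    p = q1 ++ q2 /\ last (src e) (map (@src D) q1) = tgt e.
  move: te; rewrite -map_cons => te.
  (* The index refers to [e :: p], so [take i p] ends at entry [i] of that list; [i = 0] means that
     [e] is a loop and [q1] is empty. *)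
  pose i := index (tgt e) (map (@src D) (e :: p)).
  have ilt : (i < size (e :: p))%N by rewrite -(size_map (@src D)) index_mem.
  exists (take i p), (drop i p); rewrite cat_take_drop; split=> //.
  rewrite last_map -(nth_index (tgt e) te) -/i.
  rewrite (nth_map e) //; congr src.
  rewrite (last_nth e) size_take_min.
  have -> : minn i (size p) = i by apply/minn_idPl.
  by rewrite -[e :: take i p]/(take i.+1 (e :: p)) nth_take.
move: wp up; rewrite Dp walk_to_cat lq => /andP[w1 w2].
rewrite map_cat -cat_cons cat_uniq => /and3P[u1 d12 u2].
have sq2 : simple_walk_to (tgt e) q2.
  rewrite /simple_walk_to w2 /= u2 andbT -lq.
  by apply: contra d12 => ls; apply/hasP; exists (last (src e) (map (@src D) q1));
    rewrite ?mem_last.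
have dc : dicycle_seq (rev (e :: q1)).
  apply/and3P; split; first by rewrite -size_eq0 size_rev.
    by apply: closed_walk_cycle; rewrite //= eqxx.
  by rewrite map_rev rev_uniq.
have /wC : dicycle [set f in rev (e :: q1)].
  by apply/dicycle_seqP; exists (rev (e :: q1)).
rewrite sum_set_seq; last by case/and3P: dc => _ _ /map_uniq.
rewrite (perm_big (e :: q1)) ?perm_rev //= big_cons big_cat /= => le0.
by have := maxt _ sq2; lra.
Qed.

(** * Cycle decomposition of balanced sets *)

Lemma dicycle_neq0 C : dicycle C -> C != set0.
Proof.
case/dicycle_seqP => -[//|e c] _ ->.
by apply/set0Pn; exists e; rewrite !inE eqxx.
Qed.

(* A potential rising by at least 1 along every edge of an acyclic [S] would
   contradict that potential differences cancel over a balanced [S]; edges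
   outside [S] get a weight so negative that no cycle can use them. *)
Lemma balanced_dicycle S :
  balanced S -> S != set0 -> exists2 C, dicycle C & C \subset S.
Proof.
move=> balS; have [/existsP[C /andP[]]|noC] :=
  boolP [exists C, dicycle C && (C \subset S)]; first by exists C.
pose w e : int := if e \in S then 1 else - #|edge D|%:Z.
have [C dC|pi pi_w] := @potential_exists w.
  have /subsetPn[e eC eS] : ~~ (C \subset S).
    by apply: contra noC => CS; apply/existsP; exists C; rewrite dC.
  rewrite (bigD1 e) //= {1}/w (negPf eS) addrC subr_le0.
  have le1 f : f \in C -> w f <= 1 by rewrite /w; case: ifP; lia.
  apply: le_trans (_ : \sum_(f in C | f != e) 1 <= _).
    by apply: ler_sum => f /andP[/le1].
  by rewrite sumr_const pmulrn intz lez_nat max_card.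
move=> /set0Pn[e eS].
have : \sum_(f in S) (1 : int) <= \sum_(f in S) (pi (tgt f) - pi (src f)).
  by apply: ler_sum => f fS; have := pi_w f; rewrite /w fS.
by rewrite balS sumr_const pmulrn intz (cardD1 e) eS.
Qed.

Lemma edge_disjoint_dicycles0 : @edge_disjoint_dicycles D set0.
Proof.
apply/andP; split; first by apply/forall_inP => C; rewrite inE.
by apply/trivIsetP => A B; rewrite inE.
Qed.

Lemma cover_balanced (CC : {set {set edge D}}) :
  edge_disjoint_dicycles CC -> balanced (cover CC).
Proof.
case/andP => /forall_inP dCC tCC phi; rewrite big_trivIset //=.
by apply: big1 => C /dCC /dicycle_balanced.
Qed.

(** Removing a cycle contained in [S] leaves a smaller balanced set, so induction on [#|S|]
    applies. *)
Lemma balanced_cover S :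
  balanced S ->
  exists2 CC : {set {set edge D}}, edge_disjoint_dicycles CC & cover CC = S.
Proof.
have [n] := ubnP #|S|; elim: n S => // n IHn S leSn balS.
have [->|S0] := eqVneq S set0.
  exists set0; last exact: big_set0.
  exact: edge_disjoint_dicycles0.
have [C dC sCS] := balanced_dicycle balS S0.
have [||CC /andP[/forall_inP dCC tCC] cCC] := IHn (S :\: C).
- have := card_gt0 C; rewrite (dicycle_neq0 dC) cardsDS //.
  by have := subset_leq_card sCS; lia.
- move=> phi; have := balS phi; rewrite (big_setID C) /=.
  by rewrite (setIidPr sCS) (dicycle_balanced dC) add0r.
exists (C |: CC); last first.
  rewrite /cover bigcup_setU big_set1 -/(cover CC) cCC.
  by rewrite -[RHS](setID S C) (setIidPr sCS).
apply/andP; split.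
  by apply/forall_inP => B /setU1P[->|/dCC].
have [||] // := @trivIsetU1 _ C CC _ tCC.
  move=> B BCC; rewrite disjoint_sym.
  have : B \subset S :\: C by rewrite -cCC; apply: (@bigcup_sup _ _ B).
  by rewrite subsetD => /andP[].
by apply/negP => /dCC /dicycle_neq0 /eqP.
Qed.

(** * Residual cycles and optimality *)

Definition swap S C : {set edge D} := [set e | (e \in S) (+) (e \in C)].

Lemma sum_swap S C (g : edge D -> int) :
  \sum_(e in swap S C) g e =
  \sum_(e in S) g e + \sum_(e in C) (if e \in S then - g e else g e).
Proof.
rewrite (big_mkcond (mem S)) (big_mkcond (mem C)) (big_mkcond (mem (swap S C))).
rewrite -big_split; apply: eq_bigr => e _; rewrite !inE /=.
by case: (e \in S); case: (e \in C); rewrite /= ?addr0 ?add0r ?subrr.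
Qed.

Lemma sum_mem_set F S : \sum_(e in S) (e \in F)%:Z = #|F :&: S|%:Z.
Proof.
transitivity (\sum_(e in F :&: S) (1 : int)); last first.
  by rewrite sumr_const pmulrn intz.
rewrite big_mkcond [RHS]big_mkcond; apply: eq_bigr => e _ /=.
by rewrite !inE; case: (e \in F); case: (e \in S).
Qed.

End Balanced.

(** The edge type is kept, so an edge set of the residual digraph is also one of [D]. *)
Definition residual (D : digraph) (S : {set edge D}) : digraph :=
  Digraph (fun e : edge D => if e \in S then tgt e else src e)
          (fun e : edge D => if e \in S then src e else tgt e).

Lemma swap_balanced (D : digraph) (S C : {set edge D}) :
  balanced S -> @dicycle (residual S) C -> balanced (swap S C).
Proof.
move=> balS /dicycle_balanced balC phi.
rewrite sum_swap balS add0r -[RHS](balC phi); apply: eq_bigr => e _ /=.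
by case: ifP => // _; rewrite opprB.
Qed.

Lemma residual_potential (D : digraph) (F S : {set edge D}) :
  balanced S ->
  (forall S', balanced S' -> (#|F :&: S'| <= #|F :&: S|)%N) ->
  exists pi : vertex D -> int, forall e,
    if e \in S then 0 <= (e \in F)%:Z + (pi (tgt e) - pi (src e))
    else (e \in F)%:Z + (pi (tgt e) - pi (src e)) <= 0.
Proof.
move=> balS maxS.
(* [w e] is the change in the number of [F]-edges when [e] is swapped. *)
pose w (e : edge (residual S)) : int :=
  if e \in S then - (e \in F)%:Z else (e \in F)%:Z.
have [C dC|pi pi_w] := @potential_exists (residual S) w.
  have := maxS _ (swap_balanced balS dC).
  by rewrite -lez_nat -!sum_mem_set sum_swap gerDl.
exists (fun v => - pi v) => e; have := pi_w e; rewrite /w /=.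
by case: ifP => _; lia.
Qed.

Lemma max_balanced_hitting (D : digraph) (F S : {set edge D}) :
  balanced S ->
  (forall S', balanced S' -> (#|F :&: S'| <= #|F :&: S|)%N) ->
  exists2 Y, hits_F_dicycles F Y & (#|Y| <= #|F :&: S|)%N.
Proof.
move=> balS maxS; have [pi pi_S] := residual_potential balS maxS.
pose y e : int := (e \in F)%:Z + (pi (tgt e) - pi (src e)).
pose Y := [set e in S | 0 < y e].
exists Y.
  apply/forallP => C; apply/implyP => /andP[dC /set0Pn[e /setIP[eF eC]]].
  rewrite /hits; have [YC0|//] := eqVneq (Y :&: C) set0; exfalso.
  (* A cycle missed by [Y] has no positive slack, yet its slacks add up to [#|F :&: C|], which is
     positive. *)
  have : \sum_(f in C) y f <= 0.
    apply: sumr_le0 => f fC; have := pi_S f; case: ifP => // fS _.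
    rewrite leNgt; apply/negP => yf.
    by move/setP/(_ f): YC0; rewrite !inE fS yf fC.
  rewrite big_split /= (dicycle_balanced dC) addr0 sum_mem_set lez_nat leqn0.
  by rewrite cards_eq0 => /eqP/setP/(_ e); rewrite !inE eF eC.
have sYS : Y \subset S by apply/subsetP => e; rewrite inE => /andP[].
rewrite -lez_nat -(setIidPl sYS) -!sum_mem_set.
have -> : \sum_(e in S) (e \in F)%:Z = \sum_(e in S) y e.
  by rewrite [RHS]big_split /= balS addr0.
(* By integrality, a positive slack is at least 1; the other slacks on [S] are nonnegative. *)
apply: ler_sum => e eS; rewrite inE eS /=.
by have := pi_S e; rewrite eS -/(y e); case: ltP; lia.
Qed.

Local Close Scope ring_scope.

Theorem theorem2p2 (D : digraph) (F : {set edge D}) :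
  max_F_covered F >= min_F_hitting F.
Proof.
have [CC edCC maxCC] := @arg_maxnP _ set0 (@edge_disjoint_dicycles D)
  (fun CC => #|F :&: cover CC|) (edge_disjoint_dicycles0 D).
have [|Y hitY leY] := @max_balanced_hitting D F _ (cover_balanced edCC).
  (* Every balanced set is a [cover], so maximality over collections of cycles passes to balanced
     sets. *)
  by move=> S' /balanced_cover[CC' edCC' <-]; apply: maxCC.
apply: leq_trans (leq_bigmax_cond _ edCC); apply: leq_trans leY.
rewrite /min_F_hitting; case: arg_minnP => [|Z _]; last exact.
exact: hits_F_dicycles_setT.
Qed.
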